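(* Let $d_x,d_y$ be positive integers and let $c>3d_y^2/d_x$. Consider the min-max problem $$\min_{x\in[-c,c]^{d_x}}\ \max_{y\in[-1,1]^{d_y}}\ f(x,y),\qquad f(x,y)=-(\mathbf 1^\top y)^3+(\mathbf 1^\top x)(\mathbf 1^\top y).$$ Its optimal value equals $0.25\,d_y^3$, and its set of optimal solutions is $$\left\{(x,y)\in[-c,c]^{d_x}\times[-1,1]^{d_y}\ \middle|\ \mathbf 1^\top x=0.75\,d_y^2,\ \ \mathbf 1^\top y\in\{-d_y,\,0.5\,d_y\}\right\}.$$
   Context: $\mathbf 1$ denotes the all-ones vector of the appropriate dimension. An optimal solution of $\min_x\max_y f(x,y)$ is a pair $(x^\ast,y^\ast)$ such that $x^\ast$ minimizes $x\mapsto\max_y f(x,y)$ over $[-c,c]^{d_x}$ and $y^\ast$ maximizes $f(x^\ast,\cdot)$ over $[-1,1]^{d_y}$. *)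

(* Defs.v *)
From mathcomp Require Import all_boot all_order all_algebra.
From mathcomp Require Import classical_sets reals.

Set Implicit Arguments.
Unset Strict Implicit.
Unset Printing Implicit Defensive.

Import Order.TTheory GRing.Theory Num.Theory.
Local Open Scope ring_scope.
Local Open Scope classical_set_scope.

Definition ones_dot (R : realType) (n : nat) (v : 'cV[R]_n) : R :=
  ((const_mx 1 : 'cV[R]_n)^T *m v) 0 0.

Definition box (R : realType) (n : nat) (a : R) : set 'cV[R]_n :=
  [set v | forall i, v i 0 \in `[- a, a]].

Section MinMax.
Context {R : realType} {T U : Type}.

Definition is_max (S : set R) (m : R) : Prop := S m /\ ubound S m.

Definition is_min (S : set R) (m : R) : Prop := S m /\ lbound S m.

Definition minimizes (X : set T) (phi : T -> R) (x : T) : Prop :=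
  X x /\ forall x', X x' -> phi x <= phi x'.

Definition maximizes (Y : set U) (g : U -> R) (y : U) : Prop :=
  Y y /\ forall y', Y y' -> g y' <= g y.

(* [phi] is the function x |-> max_(y in Y) f x y on X.  The maximum is
   required to be attained at every point of X; [phi] is then uniquely
   determined on X, and its values outside X play no role below. *)
Definition is_max_fun (X : set T) (Y : set U) (f : T -> U -> R)
    (phi : T -> R) : Prop :=
  forall x, X x -> is_max (f x @` Y) (phi x).

Definition minmax_value (X : set T) (Y : set U) (f : T -> U -> R) (v : R) :
    Prop :=
  exists2 phi : T -> R, is_max_fun X Y f phi & is_min (phi @` X) v.

Definition minmax_solutions (X : set T) (Y : set U) (f : T -> U -> R) :
    set (T * U) :=
  [set p | exists2 phi : T -> R, is_max_fun X Y f phi &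
             minimizes X phi p.1 /\ maximizes Y (f p.1) p.2].

End MinMax.

Definition cubic_objective (R : realType) (dx dy : nat)
    (x : 'cV[R]_dx) (y : 'cV[R]_dy) : R :=
  - ones_dot y ^+ 3 + ones_dot x * ones_dot y.

(* Main.v *)
Require Import Defs.
From mathcomp Require Import all_boot all_order all_algebra.
From mathcomp Require Import classical_sets reals.
From mathcomp Require Import ring lra.
From mathcomp Require Import boolp topology normedtype derive realfun.

(** The objective depends on [x] and [y] only through the coordinate sums
    [s = 1^T x] and [t = 1^T y], so the problem is one about the real function
    [h s t = - t ^ 3 + s * t] ([reduced_objective] below), where [t] ranges
    over the whole of [[- n, n]] with [n = dy], and where the range of [s]
    contains [3 / 4 * n ^ 2].

    Two values of [t] decide everything.  A weighted average that does not
    involve [s],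
      [1 / 3 * h s (- n) + 2 / 3 * h s (n / 2) = n ^ 3 / 4],
    shows that the inner maximum is at least [n ^ 3 / 4] for every [s], and
    that it can be that small only if [h s (- n)] and [h s (n / 2)] are both
    [n ^ 3 / 4], which forces [s = 3 / 4 * n ^ 2] (lemmas [le_reduced_max] and
    [reduced_argmin]).  Conversely, for that [s],
      [n ^ 3 / 4 - h s t = (t - n / 2) ^ 2 * (t + n)],
    which is nonnegative on [[- n, n]] and vanishes exactly at [t = n / 2] and
    [t = - n] (lemma [reduced_objective_gap]).  So the bound is attained, and
    the maximizers are visible.

    That the inner maximum is attained for every feasible [x] follows from the
    extreme value theorem in the single variable [t]. *)

Set Implicit Arguments.
Unset Strict Implicit.
Unset Printing Implicit Defensive.

Import Order.TTheory GRing.Theory Num.Theory.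
Local Open Scope ring_scope.
Local Open Scope classical_set_scope.

Import numFieldNormedType.Exports.

(** * Coordinate sums over a box *)

Lemma ones_dotE (R : realType) (n : nat) (v : 'cV[R]_n) :
  ones_dot v = \sum_(i < n) v i 0.
Proof. by rewrite /ones_dot mxE; apply: eq_bigr => i _; rewrite !mxE mul1r. Qed.

Lemma boxP (R : realType) (n : nat) (a : R) (v : 'cV[R]_n) :
  box a v <-> forall i, - a <= v i 0 <= a.
Proof. by split=> va i; have := va i; rewrite inE /= in_itv. Qed.

Lemma ones_dot_box (R : realType) (n : nat) (a : R) (v : 'cV[R]_n) :
  box a v -> - (a * n%:R) <= ones_dot v <= a * n%:R.
Proof.
move=> /boxP va; rewrite ones_dotE.
have sum_cst (b : R) : \sum_(i < n) b = b * n%:R.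
  by rewrite sumr_const card_ord mulr_natr.
rewrite -mulNr -!sum_cst; apply/andP; split; apply: ler_sum => i _;
  by have /andP[] := va i.
Qed.

(** Witnessed by a constant vector.  With the previous lemma this makes the
    range of the sum a full interval, so that the problem becomes one in a
    single real variable on each side. *)
Lemma ones_dot_box_surj (R : realType) (n : nat) (a t : R) :
  (0 < n)%N -> - (a * n%:R) <= t <= a * n%:R ->
  exists2 v : 'cV[R]_n, box a v & ones_dot v = t.
Proof.
move=> n_gt0 /andP[lt ut].
have nR_gt0 : 0 < n%:R :> R by rewrite ltr0n.
exists (const_mx (t / n%:R)).
  by apply/boxP => i; rewrite mxE ler_pdivlMr // ler_pdivrMr // mulNr lt ut.
rewrite ones_dotE (eq_bigr (fun=> t / n%:R)) => [|i _]; last by rewrite mxE.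
by rewrite sumr_const card_ord -[LHS]mulr_natr divfK // gt_eqF.
Qed.

(** * The reduced objective *)

Section ReducedObjective.
Variable R : realType.
Implicit Types n s t m : R.

Definition reduced_objective s t : R := - t ^+ 3 + s * t.

(** The weights [1 / 3] and [2 / 3] are those for which the terms in [s]
    cancel. *)
Lemma reduced_objective_average n s :
  1 / 3 * reduced_objective s (- n) + 2 / 3 * reduced_objective s (1 / 2 * n)
  = 1 / 4 * n ^+ 3.
Proof. by rewrite /reduced_objective; field. Qed.

Lemma le_reduced_max n s m :
  reduced_objective s (- n) <= m -> reduced_objective s (1 / 2 * n) <= m ->
  1 / 4 * n ^+ 3 <= m.
Proof. by have := reduced_objective_average n s; lra. Qed.

(** If both values are at most their average, they are equal to it; as
    [reduced_objective s (- n) = n ^ 3 - s * n], this determines [s]. *)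
Lemma reduced_argmin n s : 0 < n ->
  reduced_objective s (- n) <= 1 / 4 * n ^+ 3 ->
  reduced_objective s (1 / 2 * n) <= 1 / 4 * n ^+ 3 ->
  s = 3 / 4 * n ^+ 2.
Proof.
move=> n_gt0 le1 le2; have avg := reduced_objective_average n s.
have : reduced_objective s (- n) = 1 / 4 * n ^+ 3 by lra.
rewrite /reduced_objective => eq1.
by apply: (mulIf (lt0r_neq0 n_gt0)); lra.
Qed.

Lemma reduced_objective_gap n t :
  1 / 4 * n ^+ 3 - reduced_objective (3 / 4 * n ^+ 2) t
  = (t - 1 / 2 * n) ^+ 2 * (t + n).
Proof. by rewrite /reduced_objective; field. Qed.

Lemma reduced_objective_le n t : - n <= t ->
  reduced_objective (3 / 4 * n ^+ 2) t <= 1 / 4 * n ^+ 3.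
Proof.
move=> nt; rewrite -subr_ge0 reduced_objective_gap.
by rewrite mulr_ge0 ?sqr_ge0 // -lerBlDr sub0r.
Qed.

Lemma reduced_objective_eqP n t :
  reduced_objective (3 / 4 * n ^+ 2) t = 1 / 4 * n ^+ 3 <->
  t = - n \/ t = 1 / 2 * n.
Proof.
split=> [eqt|]; last by case=> ->; rewrite /reduced_objective; field.
have /esym/eqP := reduced_objective_gap n t.
rewrite eqt subrr mulf_eq0 sqrf_eq0 subr_eq0 addr_eq0.
by case/orP=> /eqP; [right|left].
Qed.

Lemma reduced_max_attained n s : 0 <= n ->
  exists2 t, - n <= t <= n &
    forall t', - n <= t' <= n ->
      reduced_objective s t' <= reduced_objective s t.
Proof.
move=> n_ge0.
have [||t] := @EVT_max R (reduced_objective s) (- n) n; first by rewrite ge0_cp.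
  apply: continuous_subspaceT => t; apply: cvgD.
    by apply: cvgN; apply: exprn_continuous.
  by apply: cvgM; [exact: cvg_cst|exact: cvg_id].
by rewrite in_itv /= => tn t_max; exists t.
Qed.

End ReducedObjective.

(** * Max functions and min-max solutions *)

Section MinMaxFacts.
Context {R : realType} {T U : Type}.
Implicit Types (X : set T) (Y : set U) (f : T -> U -> R) (phi : T -> R).

Lemma max_fun_exists X Y f :
  (forall x, X x -> exists y, maximizes Y (f x) y) ->
  exists phi, is_max_fun X Y f phi.
Proof.
move=> ex_max.
have /choice[phi phiP] : forall x, exists m, X x -> is_max (f x @` Y) m.
  move=> x; have [Xx|nXx] := pselect (X x); last by exists 0.
  have [y [Yy ymax]] := ex_max x Xx; exists (f x y) => _.
  by split=> [|_ [y' Yy' <-]]; [exists y|exact: ymax].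
by exists phi.
Qed.

Lemma max_fun_ge X Y f phi x y :
  is_max_fun X Y f phi -> X x -> Y y -> f x y <= phi x.
Proof. by move=> phiP Xx Yy; apply: (phiP x Xx).2; exists y. Qed.

Lemma max_fun_le X Y f phi x m :
  is_max_fun X Y f phi -> X x -> (forall y, Y y -> f x y <= m) -> phi x <= m.
Proof. by move=> phiP Xx le_m; have [[y Yy <-] _] := phiP x Xx; apply: le_m. Qed.

End MinMaxFacts.

(** * The cubic min-max problem *)

Theorem proposition4p1 (R : realType) (dx dy : nat) (c : R)
    (dx_gt0 : (0 < dx)%N) (dy_gt0 : (0 < dy)%N)
    (c_large : 3 * dy%:R ^+ 2 / dx%:R < c) :
  minmax_value (box c) (box 1) (@cubic_objective R dx dy)
    (1 / 4 * dy%:R ^+ 3) /\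
  minmax_solutions (box c) (box 1) (@cubic_objective R dx dy) =
    [set p : 'cV[R]_dx * 'cV[R]_dy |
       [/\ box c p.1, box 1 p.2,
           ones_dot p.1 = 3 / 4 * dy%:R ^+ 2 &
           ones_dot p.2 = - dy%:R \/ ones_dot p.2 = 1 / 2 * dy%:R]].
Proof.
set n : R := dy%:R in c_large *; set X := box c; set Y := box 1.
have n_gt0 : 0 < n by rewrite ltr0n.
have Y_range y : Y y -> - n <= ones_dot y.
  by move=> /ones_dot_box; rewrite mul1r => /andP[].
have Y_surj t : - n <= t <= n -> exists2 y, Y y & ones_dot y = t.
  by move=> tn; apply: ones_dot_box_surj; rewrite ?mul1r.
have [yn Yyn yn_sum] : exists2 y, Y y & ones_dot y = - n.
  by apply: Y_surj; apply/andP; split; lra.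
have [yh Yyh yh_sum] : exists2 y, Y y & ones_dot y = 1 / 2 * n.
  by apply: Y_surj; apply/andP; split; lra.
have [x0 Xx0 x0_sum] : exists2 x, X x & ones_dot x = 3 / 4 * n ^+ 2.
  apply: ones_dot_box_surj => //.
  move: c_large; rewrite ltr_pdivrMr ?ltr0n // => c_large.
  by have n2_ge0 := sqr_ge0 n; apply/andP; split; lra.
have fE (x : 'cV[R]_dx) (y : 'cV[R]_dy) :
  cubic_objective x y = reduced_objective (ones_dot x) (ones_dot y) by [].
have [phi phiP] : exists phi, is_max_fun X Y (@cubic_objective R dx dy) phi.
  apply: max_fun_exists => x _.
  have [t tn tmax] := reduced_max_attained (ones_dot x) (ltW n_gt0).
  have [y Yy y_sum] := Y_surj t tn; exists y; split=> // y' /ones_dot_box.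
  by rewrite mul1r !fE y_sum; exact: tmax.
(* These hold for every function that gives the inner maximum on [X], since
   a solution may come with one different from [phi] outside [X]. *)
have max_at psi x : is_max_fun X Y (@cubic_objective R dx dy) psi -> X x ->
    reduced_objective (ones_dot x) (- n) <= psi x /\
    reduced_objective (ones_dot x) (1 / 2 * n) <= psi x.
  move=> psiP Xx; rewrite -{1}yn_sum -yh_sum -!fE.
  by split; apply: max_fun_ge psiP _ _.
have min_ge psi x : is_max_fun X Y (@cubic_objective R dx dy) psi -> X x ->
    1 / 4 * n ^+ 3 <= psi x.
  by move=> psiP Xx; have [] := max_at psi x psiP Xx; exact: le_reduced_max.
have min_le psi x : is_max_fun X Y (@cubic_objective R dx dy) psi -> X x ->
    ones_dot x = 3 / 4 * n ^+ 2 -> psi x <= 1 / 4 * n ^+ 3.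
  move=> psiP Xx x_sum; apply: (max_fun_le psiP Xx) => y /Y_range.
  by rewrite fE x_sum; exact: reduced_objective_le.
split.
  exists phi => //; split=> [|_ [x Xx <-]]; last exact: min_ge.
  by exists x0 => //; apply/le_anti; rewrite min_ge ?min_le.
apply/seteqP; split=> -[x y] /=.
- case=> psi psiP [[Xx x_min] [Yy y_max]].
  have psi_le : psi x <= 1 / 4 * n ^+ 3.
    by apply: le_trans (x_min _ Xx0) _; exact: min_le.
  have x_sum : ones_dot x = 3 / 4 * n ^+ 2.
    have [le1 le2] := max_at psi x psiP Xx.
    apply: reduced_argmin => //; first exact: le_trans le1 _.
    exact: le_trans le2 _.
  split=> //; apply/reduced_objective_eqP/le_anti.
  rewrite reduced_objective_le ?Y_range //=.
  have /reduced_objective_eqP <- : - n = - n \/ - n = 1 / 2 * n by left.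
  by have := y_max _ Yyn; rewrite !fE x_sum yn_sum.
- case=> Xx Yy x_sum /reduced_objective_eqP y_val; exists phi => //.
  split; split=> //.
    by move=> x' Xx'; apply: le_trans (min_ge phi x' phiP Xx'); exact: min_le.
  by move=> y' /Y_range y'n; rewrite !fE x_sum y_val reduced_objective_le.
Qed.
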